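(* Let $m\ge 3$ be odd, let $\tilde M=(\tilde m_{i,j})_{i,j\in[0,m-1]}$ be a magic square of side $m$ with magic constant $\tilde\mu$, and let $Q$ be the $2m\times 2m$ $D_{2m^2}$-semi-magic square built from $\tilde M$ with blocks $Q^{11},Q^{12},Q^{21},Q^{22}$ as described in the context. Let $i,j,c\in[0,m-1]$. For $u,v\in\{1,2\}$ with $u+v$ odd, $$\rho^{uv}_{i,c}=\begin{cases} r^{2\tilde\mu-(m-2)(m-1)/2+1}, & c \text{ odd or } c=0,\\ r^{-2\tilde\mu+(m-2)(m-1)/2-1}, & c\text{ even and } c\neq 0,\end{cases}$$ $$\sigma^{uv}_{j,c}=\begin{cases} r^{2\tilde\mu-(m-2)(m-1)/2+1}, & c \text{ odd or } c=0,\\ r^{-2\tilde\mu+(m-2)(m-1)/2-1}, & c\text{ even and } c\neq 0.\end{cases}$$ Consequently, the magic constant of $Q$ depends on the chosen ordering: the row products are $$\rho_i=\rho^{u1}_{i,0}\,\rho^{u2}_{i,c}=\begin{cases} r^{4\tilde\mu-(m-2)(m-1)/2+1}, & c \text{ odd or } c=0,\\ r^{(m-2)(m-1)/2-1}, & c\text{ even and } c\neq 0,\end{cases}$$ and similarly the column products are $$\sigma_j=\sigma^{1v}_{j,0}\,\sigma^{2v}_{j,c}=\begin{cases} r^{4\tilde\mu-(m-2)(m-1)/2+1}, & c \text{ odd or } c=0,\\ r^{(m-2)(m-1)/2-1}, & c\text{ even and } c\neq 0.\end{cases}$$ Thus two distinct magic constants may arise from the same semi-magic square $Q$, depending on the order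 in which the products are taken.
   Context: $[a,b]$ denotes the set of integers from $a$ to $b$ (empty if $a>b$). The dihedral group $D_k$ ($k\ge3$) has order $2k$ and elements $r^i$ (rotations) and $r^is$ (reflections), $0\le i\le k-1$, with $r^k=e$, $(r^is)^2=e$, $r^is=sr^{-i}$. A magic square of side $m$ is an $m\times m$ array containing each of $1,2,\dots,m^2$ exactly once such that every row, every column and both main diagonals have the same sum $\tilde\mu=m(m^2+1)/2$ (the magic constant). For a group $\Gamma$ of order $n^2$, a $\Gamma$-semi-magic square of side $n$ with magic constant $\mu\in\Gamma$ is an $n\times n$ array containing each element of $\Gamma$ exactly once such that for every row, and for every column, there is an ordering of its entries in which their product equals $\mu$. Construction of $Q$ for $m$ odd. Row and column indices $i,j$ range over $[0,m-1]$; subscripts of $e,o,t$ and $q$ are read modulo $m$, and exponents of $r$ are read modulo $2m^2$. Put $e_{i,j}=2\tilde m_{i,j}$, $o_{i,j}=2\tilde m_{i,j}+1$, $t_{i,j}=-2\tilde m_{i,j}+m-2$ (all modulo $2m^2$). Define $m\times m$ arrays $Q^{uv}=(q^{uv}_{i,j})$, $u,v\in\{1,2\}$, by - $q^{11}_{i,j}=r^{e_{i,j}}$ for all $i,j$; - $q^{22}_{i,j}=r^{e_{i,j}}s$ if $j=i$; $\;r^{t_{i,j}}s$ if $j\equiv i+1\pmod m$; $\;r^{o_{i,j}}$ otherwise; - $q^{12}_{i,j}=r^{o_{i,j}}$ if $j=i$; $\;r^{e_{i,j}}s$ if $i+j$ is odd and $j\in[i+1,m-1]$, or $i+j$ is even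 and $j\in[0,i-1]$; $\;r^{t_{i,j}}s$ if $i+j$ is even and $j\in[i+2,m-1]$, or $i+j$ is odd and $j\in[0,i-1]$; - $q^{21}_{i,j}=r^{o_{i,j+1}}$ if $j=i$; $\;r^{e_{i,j+1}}s$ if $i+j$ is odd and $j\in[i+1,m-1]$, or $i+j$ is even and $j\in[0,i-1]$; $\;r^{t_{i,j+1}}s$ if $i+j$ is even and $j\in[i+2,m-1]$, or $i+j$ is odd and $j\in[0,i-1]$. The square $Q$ is the $2m\times 2m$ block array with $Q^{11}$ top left, $Q^{12}$ top right, $Q^{21}$ bottom left, $Q^{22}$ bottom right. A row of $Q$ is given by $u\in\{1,2\}$ and $i\in[0,m-1]$ (row $i$ of $Q^{u1}$ followed by row $i$ of $Q^{u2}$), and a column by $v\in\{1,2\}$ and $j\in[0,m-1]$ (column $j$ of $Q^{1v}$ above column $j$ of $Q^{2v}$); $\rho_i$ and $\sigma_j$ denote the corresponding row and column products. For $c\in[0,m-1]$, define the products of all $m$ entries of a row or column of a block, taken in cyclic order (subscripts modulo $m$): $$\rho^{uv}_{i,c}=q^{uv}_{i,i+c}\,q^{uv}_{i,i+c+1}\cdots q^{uv}_{i,i+c-1},\qquad \sigma^{uv}_{j,c}=q^{uv}_{j-c,j}\,q^{uv}_{j-c-1,j}\cdots q^{uv}_{j-c+1,j}.$$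
   Formalization: For u=2 (rows) and v=2 (columns) the displayed product fails (e.g. c=1); the formal version puts offset c on the block with u+v odd and 0 on the block with u=v. For m=5 the two magic constants coincide, so distinctness is stated as holding exactly when m≠5. *)

(* Defs.v *)
From HB Require Import structures.
From mathcomp Require Import all_boot all_order all_algebra all_fingroup.
From mathcomp Require Import all_solvable.

Set Implicit Arguments.
Unset Strict Implicit.
Unset Printing Implicit Defensive.

Import GroupScope.

(* x to an integer power: [ssrint] only provides this for unit rings. *)
Definition zexpg (gT : groupType) (x : gT) (z : int) : gT :=
  match z with Posz n => x ^+ n | Negz n => x ^- n.+1 end.

(* gT is the dihedral group of order 2k with rotation r and reflection s. *)
Definition dihedral_gens (gT : finGroupType) (k : nat) (r s : gT) : Prop :=
  [/\ r ^+ k = 1,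
      forall i : nat, (r ^+ i * s) ^+ 2 = 1,
      forall i : nat, r ^+ i * s = s * r ^- i
    & forall g : gT, exists! p : 'I_k * bool, g = r ^+ p.1 * s ^+ p.2].

(* The library's 'D_m is indexed by its order and carries no distinguished
   generators; r and s as above do exist in it. *)
Lemma dihedral_gens_exist (k : nat) :
  (1 < k)%N -> exists r s : 'D_(2 * k), dihedral_gens k r s.
Proof.
move=> k1; rewrite mul2n.
have oG := card_dihedral k1.
have /existsP[[x y] /= /eqP[defG xq y2 xy]] :
    'D_(k.*2) \homg Grp (x : y : x ^+ k, y ^+ 2, x ^ y = x^-1).
  by rewrite -(Grp_dihedral k1) homg_refl.
have rel (i : nat) : x ^+ i * y = y * x ^- i.
  by rewrite conjgC conjXg xy expVgn.
have sq i : (x ^+ i * y) ^+ 2 = 1.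
  by rewrite expgS expg1 {1}rel mulgA -(mulgA y) mulVg mulg1 -[y * y]/(y ^+ 2).
have defG': <[x]> * <[y]> = [set: 'D_(k.*2)].
  by rewrite -norm_joinEr // norms_cycle xy groupV cycle_id.
pose F (p : 'I_k * bool) := x ^+ p.1 * y ^+ p.2.
have surj g : exists p, g = F p.
  have : g \in <[x]> * <[y]> by rewrite defG' inE.
  case/mulsgP=> _ _ /cycleP[i ->] /cycleP[j ->] ->.
  have k0: (0 < k)%N by exact: ltnW.
  exists (Ordinal (ltn_pmod i k0), odd j); rewrite /F /= (expg_mod _ xq); congr (_ * _).
  by rewrite -(expg_mod _ y2) modn2.
have injF : injective F.
  have : #|codom F| == #|{: 'I_k * bool}|.
    rewrite card_prod card_ord card_bool muln2.
    rewrite -[X in _ == X]oG; apply/eqP/eq_card => g; rewrite inE.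
    by have [p ->] := surj g; apply/codomP; exists p.
  by move/image_injP => H p q E; apply: H.
exists x, y; split=> // g; have [p ->] := surj g; exists p; split=> // q.
exact: injF.
Qed.

Definition magic_const (m : nat) : nat := ((m * (m ^ 2 + 1)) %/ 2)%N.

Definition is_magic_square (m : nat) (M : 'M[nat]_m) : Prop :=
  perm_eq [seq M p.1 p.2 | p : 'I_m * 'I_m] (iota 1 (m ^ 2)) /\
  [/\ forall i, (\sum_(j < m) M i j)%N = magic_const m,
      forall j, (\sum_(i < m) M i j)%N = magic_const m,
      (\sum_(i < m) M i i)%N = magic_const m
    & (\sum_(i < m) M i (rev_ord i))%N = magic_const m].

(* gT need not be abelian: the permutation is the order in which the entries
   of the line are multiplied, and it may vary from line to line. *)
Definition is_semi_magic (gT : finGroupType) (n : nat) (A : 'M[gT]_n)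
    (mu : gT) : Prop :=
  [/\ #|gT| = (n ^ 2)%N,
      perm_eq [seq A p.1 p.2 | p : 'I_n * 'I_n] (enum gT),
      forall i, exists f : {perm 'I_n}, \prod_(k < n) A i (f k) = mu
    & forall j, exists f : {perm 'I_n}, \prod_(k < n) A (f k) j = mu].

Section Blocks.

Variables (gT : groupType) (m : nat) (M : 'M[nat]_m) (r s : gT).

(* Exponents are kept in int; they only matter modulo 2m^2 = #[r]. *)
Definition e_exp (i j : 'I_m) : int := (2 * M i j)%N%:Z.
Definition o_exp (i j : 'I_m) : int := (2 * M i j + 1)%N%:Z.
Definition t_exp (i j : 'I_m) : int := (- (2 * M i j)%N%:Z + m%:Z - 2)%R.

(* Entry (i, j) of Q^12 and of Q^21: the shape depends on (i, j), while M is
   read in column j', equal to j for Q^12 and to j + 1 mod m for Q^21. *)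
Definition q_off (i j j' : 'I_m) : gT :=
  if j == i then zexpg r (o_exp i j')
  else if odd (i + j) && (i < j)%N || ~~ odd (i + j) && (j < i)%N
  then zexpg r (e_exp i j') * s
  else zexpg r (t_exp i j') * s.

Definition Q11 : 'M[gT]_m := \matrix_(i, j) zexpg r (e_exp i j).

Definition Q12 : 'M[gT]_m := \matrix_(i, j) q_off i j j.

Definition Q21 : 'M[gT]_m := \matrix_(i, j) q_off i j (ordS j).

Definition Q22 : 'M[gT]_m := \matrix_(i, j)
  if j == i then zexpg r (e_exp i j) * s
  else if j == ordS i then zexpg r (t_exp i j) * s
  else zexpg r (o_exp i j).

(* Block Q^uv; only u, v \in {1, 2} are meaningful. *)
Definition Qblock (u v : nat) : 'M[gT]_m :=
  match u, v with
  | 1, 1 => Q11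
  | 1, 2 => Q12
  | 2, 1 => Q21
  | _, _ => Q22
  end.

Definition Qsquare : 'M[gT]_(m + m) := block_mx Q11 Q12 Q21 Q22.

End Blocks.

(* Product of row i of A, from column i + c rightwards, cyclically. *)
Definition row_prod (gT : groupType) (m : nat) (A : 'M[gT]_m) (i : 'I_m)
    (c : nat) : gT :=
  \prod_(k < m) A i (iter (c + k) (@ordS m) i).

(* Product of column j of A, from row j - c upwards, cyclically. *)
Definition col_prod (gT : groupType) (m : nat) (A : 'M[gT]_m) (j : 'I_m)
    (c : nat) : gT :=
  \prod_(k < m) A (iter (c + k) (@ord_pred m) j) j.

(* In a full line of Q, the block with u + v odd is multiplied with offset c and
   the block with u = v with offset 0 (the product over a block with u = v also
   depends on its offset, in a different way). *)
Definition offs (u v c : nat) : nat := if odd (u + v) then c else 0.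

(* Main.v *)
Require Import Defs.
From mathcomp Require Import all_boot all_order all_algebra all_fingroup.
From mathcomp Require Import all_solvable.
From mathcomp Require Import zify ring.

(** In every line of [Q^12] and [Q^21], read cyclically from the diagonal, one odd
    rotation is followed by reflections alternating between exponents [2a] and
    [-2a + m - 2], so the product is a rotation [r^S], where [S] only depends on the
    line sum of [M]. Starting the product at offset [c] conjugates it by the product
    of the first [c] entries, which is a reflection exactly when [c] is even and
    nonzero; in that case [r^S] becomes [r^(-S)]. Every group element occurs in [Q]
    because the exponents [2a], [2a + 1] and [-2a + m - 2] run over the residues
    modulo [2m^2] of their parity; by cardinality it occurs exactly once. Finally
    [C1 / C2 = r^(m (2 m^2 - m + 5))], which is trivial iff [2m] divides
    [2 m^2 - m + 5], that is, iff [m = 5]. *)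

(** * Integer powers and computation in a dihedral group *)

Section Dihedral.

Set Implicit Arguments.
Unset Strict Implicit.
Import GroupScope.

Lemma zexpg_subn (gT : groupType) (x : gT) (m n : nat) :
  zexpg x (m%:Z - n%:Z)%R = x ^+ m * x ^- n.
Proof.
have [le_nm | lt_mn] := leqP n m.
  have -> : (m%:Z - n%:Z)%R = Posz (m - n) by lia.
  by rewrite /= expgnFr.
have -> : (m%:Z - n%:Z)%R = Negz (n - m).-1 by lia.
by rewrite /= prednK ?subn_gt0 // expgnFr ?(ltnW lt_mn) // invMg invgK.
Qed.

Lemma zexpgD (gT : groupType) (x : gT) (a b : int) :
  zexpg x (a + b)%R = zexpg x a * zexpg x b.
Proof.
have split_int (c : int) : exists m n : nat, c = (m%:Z - n%:Z)%R.
  by case: c => k; [exists k, 0%N | exists 0%N, k.+1]; lia.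
have [m [n ->]] := split_int a; have [p [q ->]] := split_int b.
have -> : (m%:Z - n%:Z + (p%:Z - q%:Z))%R = ((m + p)%:Z - (q + n)%:Z)%R by lia.
rewrite !zexpg_subn !expgnDr invMg -!mulgA; congr (_ * _).
rewrite !mulgA; congr (_ * _).
by apply/commuteV/commuteX2.
Qed.

Lemma zexpgN (gT : groupType) (x : gT) (a : int) :
  zexpg x (- a)%R = (zexpg x a)^-1.
Proof. by apply: (mulgI (zexpg x a)); rewrite -zexpgD mulgV GRing.subrr. Qed.

Lemma zexpg_eq1 (gT : finGroupType) (x : gT) (a : int) :
  (zexpg x a == 1) = (#[x] %| `|a|)%N.
Proof. by rewrite order_dvdn; case: a => k //=; rewrite invg_eq1. Qed.

Lemma eq_zexpg (gT : finGroupType) (x : gT) (a b : int) :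
  (zexpg x a == zexpg x b) = (#[x] %| `|a - b|)%N.
Proof. by rewrite -zexpg_eq1 zexpgD zexpgN eq_mulgV1. Qed.

(** If [P] is the product of the first [c] factors and [R] that of the others, the shifted product
    is [R P], which is [P^-1 (P R) P]. *)
Lemma prod_cyclic_shift (gT : groupType) (m c : nat) (h : nat -> gT) :
  (c <= m)%N ->
  \prod_(k < m) h ((c + k) %% m)%N = (\prod_(k < m) h k) ^ (\prod_(k < c) h k).
Proof.
move=> le_cm.
rewrite -!(big_mkord xpredT) /= -(big_mkord xpredT (fun k => h ((c + k) %% m)%N)).
rewrite [X in _ = X ^ _](big_cat_nat (n := c)) //= conjgE mulgA mulKg.
rewrite (big_cat_nat (n := m - c)) ?leq_subr //=; congr (_ * _).
  rewrite (big_addn 0 m c) big_nat [RHS]big_nat; apply: eq_bigr => k /andP[_ lt_k].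
  rewrite modn_small; [by rewrite addnC | lia].
rewrite (big_addn 0 m (m - c)) subKn // big_nat [RHS]big_nat.
apply: eq_bigr => k /andP[_ lt_k].
have -> : (c + (k + (m - c)) = k + m)%N by lia.
by rewrite modnDr modn_small // (leq_trans lt_k).
Qed.

Section Relations.

Variables (gT : finGroupType) (n : nat) (r s : gT).
Hypothesis rsD : dihedral_gens n r s.

Lemma dihedral_gens_gt0 : (0 < n)%N.
Proof. by case: rsD => _ _ _ /(_ 1)[[[i lt_in] b] _]; apply: leq_ltn_trans lt_in. Qed.

Lemma dihedral_gens_sqr : s * s = 1.
Proof. by case: rsD => _ /(_ 0%N); rewrite mul1g expg2. Qed.

(** Uniqueness of normal forms is what bounds the order from below: if [#[r] < n], the identity
    would have the two normal forms [r^0] and [r^#[r]]. *)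
Lemma dihedral_gens_order : #[r] = n.
Proof.
have n_gt0 := dihedral_gens_gt0; case: rsD => rn _ _ uniq_rs.
apply/eqP; rewrite eqn_dvd order_dvdn rn eqxx /=.
apply/negPn/negP => ndvd.
have lt_o : (#[r] < n)%N.
  rewrite ltn_neqAle dvdn_leq ?order_dvdn ?rn // andbT.
  by apply: contraNneq ndvd => ->.
have [p [_ uniq_p]] := uniq_rs 1.
have := uniq_p (Ordinal n_gt0, false); rewrite /= mulg1 => /(_ erefl) p0.
have := uniq_p (Ordinal lt_o, false); rewrite /= mulg1 expg_order => /(_ erefl).
by rewrite p0 => -[] /eqP; rewrite eq_sym -leqn0 leqNgt order_gt0.
Qed.

Lemma card_dihedral_gens : #|gT| = (2 * n)%N.
Proof.
case: rsD => _ _ _ uniq_rs; pose F (p : 'I_n * bool) := r ^+ p.1 * s ^+ p.2.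
rewrite -[n]card_ord -card_bool mulnC -card_prod -(card_codom (f := F)).
  apply/esym/eq_card => g; rewrite inE; apply/codomP.
  by have [p [-> _]] := uniq_rs g; exists p.
move=> p q eqF; have [t [_ uniq_t]] := uniq_rs (F p).
by rewrite -(uniq_t p) // -(uniq_t q).
Qed.

Lemma dihedral_genP g : exists (a : nat) (b : bool), g = zexpg r (Posz a) * s ^+ b.
Proof. by case: rsD => _ _ _ /(_ g)[[i b] [-> _]]; exists i, b. Qed.

Lemma mul_s_zexpg (a : int) : s * zexpg r a = zexpg r (- a)%R * s.
Proof.
case: rsD => _ _ rs _; case: a => k.
  rewrite zexpgN /=; apply: (mulgI (r ^+ k)).
  by rewrite mulKVg mulgA rs -mulgA mulVg mulg1.
by rewrite NegzE GRing.opprK -NegzE /= -rs.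
Qed.

Lemma mul_refl_rot (a b : int) :
  zexpg r a * s * zexpg r b = zexpg r (a - b)%R * s.
Proof. by rewrite -mulgA mul_s_zexpg mulgA -zexpgD. Qed.

Lemma mul_refl_refl (a b : int) :
  zexpg r a * s * (zexpg r b * s) = zexpg r (a - b)%R.
Proof. by rewrite mulgA mul_refl_rot -mulgA dihedral_gens_sqr mulg1. Qed.

Lemma conj_rot (a b : int) (x : bool) :
  zexpg r a ^ (zexpg r b * s ^+ x) = zexpg r ((-1) ^+ x * a)%R.
Proof.
have fix_rot : zexpg r a ^ zexpg r b = zexpg r a.
  by rewrite conjgE -zexpgN -!zexpgD; congr (zexpg r _); ring.
rewrite conjgM fix_rot.
case: x; rewrite /= ?conjg1 ?GRing.mul1r // GRing.mulN1r.
by apply: (mulgI s); rewrite -conjgC mul_s_zexpg GRing.opprK.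
Qed.

End Relations.
End Dihedral.

(** * Cyclic indices modulo [m] and orderings of a line *)

Section CyclicIndices.

Set Implicit Arguments.
Unset Strict Implicit.

Variable m : nat.
Implicit Types (i j : 'I_m).

Lemma val_iter_ordS d i : iter d (@ordS m) i = ((i + d) %% m)%N :> nat.
Proof.
elim: d => [|d IHd] /=; first by rewrite addn0 modn_small.
by rewrite IHd -addn1 modnDml addn1 addnS.
Qed.

Lemma iter_ordS_mod d i : iter (d %% m) (@ordS m) i = iter d (@ordS m) i.
Proof. by apply: ord_inj; rewrite !val_iter_ordS modnDmr. Qed.

Lemma iter_ord_predK d j : iter d (@ordS m) (iter d (@ord_pred m) j) = j.
Proof.
by elim: d j => //= d IHd j; rewrite -iterS iterSr ord_predK IHd.
Qed.

Lemma iter_ordS_inj d : injective (iter d (@ordS m)).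
Proof. by elim: d => // d IHd i j /ordS_inj/IHd. Qed.

Lemma iter_ord_pred_mod d j : iter (d %% m) (@ord_pred m) j = iter d (@ord_pred m) j.
Proof.
apply: (@iter_ordS_inj d); rewrite iter_ord_predK.
by rewrite -iter_ordS_mod iter_ord_predK.
Qed.

Lemma iter_ordS_index_inj i c : injective (fun k : 'I_m => iter (c + k) (@ordS m) i).
Proof.
move=> k k' /(congr1 val); rewrite /= !val_iter_ordS !addnA => /eqP.
by rewrite eqn_modDl !modn_small // => /eqP/val_inj.
Qed.

Lemma iter_ord_pred_index_inj j c :
  injective (fun k : 'I_m => iter (c + k) (@ord_pred m) j).
Proof.
move=> k k' eq_kk'; have := iter_ord_predK (c + k) j.
rewrite eq_kk' -{2}(iter_ord_predK (c + k') j).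
exact: iter_ordS_index_inj.
Qed.

(** Reducing the index modulo [m] gives the shape required by [prod_cyclic_shift]. *)
Lemma row_prod_shift (gT : groupType) (A : 'M[gT]_m) i c :
  row_prod A i c = (\prod_(k < m) A i (iter ((c + k) %% m) (@ordS m) i))%g.
Proof. by apply: eq_bigr => k _; rewrite iter_ordS_mod. Qed.

Lemma col_prod_shift (gT : groupType) (A : 'M[gT]_m) j c :
  col_prod A j c = (\prod_(k < m) A (iter ((c + k) %% m) (@ord_pred m) j) j)%g.
Proof. by apply: eq_bigr => k _; rewrite iter_ord_pred_mod. Qed.

Lemma sum_iter_ordS (F : 'I_m -> nat) i :
  (\sum_(d < m) F (iter d (@ordS m) i) = \sum_j F j)%N.
Proof. by rewrite [RHS](reindex_inj (@iter_ordS_index_inj i 0)). Qed.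

Lemma sum_iter_ord_pred (F : 'I_m -> nat) j :
  (\sum_(d < m) F (iter d (@ord_pred m) j) = \sum_i F i)%N.
Proof. by rewrite [RHS](reindex_inj (@iter_ord_pred_index_inj j 0)). Qed.

Lemma iter_ordSP i j : exists2 d, (d < m)%N & j = iter d (@ordS m) i.
Proof.
(* This is [j - i] modulo [m], with [m - i] in place of [- i] to avoid truncated subtraction. *)
exists ((j + (m - i)) %% m)%N; first by rewrite ltn_mod (leq_ltn_trans _ (ltn_ord i)).
apply: ord_inj; rewrite iter_ordS_mod /= val_iter_ordS.
by rewrite addnCA subnKC ?(ltnW (ltn_ord i)) // modnDr modn_small.
Qed.

(** Turns a reading order on each half of a line into the single permutation of the whole line that
    [is_semi_magic] asks for. *)
Lemma prod_two_blocks (gT : groupType) (g1 g2 : 'I_m -> 'I_m) (F : 'I_(m + m) -> gT) :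
  injective g1 -> injective g2 ->
  exists f : {perm 'I_(m + m)},
    (\prod_k F (f k) =
     (\prod_k F (lshift m (g1 k))) * (\prod_k F (rshift m (g2 k))))%g.
Proof.
move=> g1_inj g2_inj.
pose f k := match split k with inl k => lshift m (g1 k) | inr k => rshift m (g2 k) end.
have f_inj : injective f.
  move=> k k'; rewrite /f.
  case: split_ordP => x ->; case: split_ordP => y ->.
  - by move/lshift_inj/g1_inj->.
  - by move/eqP; rewrite eq_lrshift.
  - by move/eqP; rewrite eq_rlshift.
  - by move/rshift_inj/g2_inj->.
exists (perm f_inj); rewrite big_split_ord /=.
congr (_ * _)%g; apply: eq_bigr => k _; rewrite permE /f.
  by case: split_ordP => x /eqP; rewrite ?eq_lrshift // => /eqP/lshift_inj->.
by case: split_ordP => x /eqP; rewrite ?eq_rlshift // => /eqP/rshift_inj->.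
Qed.

End CyclicIndices.

(** * Products along one line of a block *)

Section Lines.

Set Implicit Arguments.
Unset Strict Implicit.
Local Arguments zexpg : simpl never.
Import GroupScope.

Variables (gT : finGroupType) (n : nat) (r s : gT).
Hypothesis rsD : dihedral_gens n r s.
Variable m : nat.
Hypothesis m_ge3 : (3 <= m)%N.

(* Since m is odd, the case distinction defining Q^12 and Q^21 only depends on
   the residue d of j - i modulo m. *)
Definition off_entry (a d : nat) : gT :=
  if d == 0%N then zexpg r (2 * a + 1)%N
  else if odd d then zexpg r (2 * a)%N * s
  else zexpg r (- (2 * a)%N%:Z + m%:Z - 2)%R * s.

Definition diag_entry (a d : nat) : gT :=
  if d == 0%N then zexpg r (2 * a)%N * s
  else if d == 1%N then zexpg r (- (2 * a)%N%:Z + m%:Z - 2)%R * s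
  else zexpg r (2 * a + 1)%N.

Lemma Q22E (M : 'M[nat]_m) (i j : 'I_m) (d : nat) :
  (d < m)%N -> j = iter d (@ordS m) i -> Q22 M r s i j = diag_entry (M i j) d.
Proof.
move=> lt_dm eq_j; rewrite mxE /diag_entry.
have iter_eq k : (k < m)%N -> (j == iter k (@ordS m) i) = (d == k).
  move=> lt_km; rewrite eq_j -(inj_eq val_inj) /= !val_iter_ordS eqn_modDl.
  by rewrite !modn_small.
by rewrite (iter_eq 0%N) ?(iter_eq 1%N) //; lia.
Qed.

(** After the initial rotation, which accounts for the [+ 1], each pair of consecutive reflections
    [r^(2a) s], [r^(-2b+m-2) s] multiplies to [r^(2a+2b-(m-2))]. Hence [l./2] corrections by
    [m - 2], and a leftover [s] when [l] is odd. *)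
Lemma prod_off_prefix (a : nat -> nat) (l : nat) :
  \prod_(d < l.+1) off_entry (a d) d =
    zexpg r (2 * (\sum_(d < l.+1) a d)%N%:Z + 1 - (l./2)%:Z * (m%:Z - 2))%R
      * s ^+ odd l.
Proof.
elim: l => [|l IHl]; first by rewrite !big_ord1 mulg1 /off_entry /=; congr (zexpg r _); lia.
have sumS : (\sum_(d < l.+2) a d = \sum_(d < l.+1) a d + a l.+1)%N by rewrite big_ord_recr.
rewrite big_ord_recr IHl sumS /= /off_entry /= uphalf_half.
move: (\sum_(d < l.+1) a d)%N => S.
case: (odd l); rewrite /= ?expg1 ?mulg1.
  by rewrite (mul_refl_refl rsD); congr (zexpg r _); lia.
by rewrite mulgA -zexpgD; congr (zexpg r _ * s); lia.
Qed.

(** The two leading reflections multiply to a rotation with correction [-(m - 2)]; each of the [l]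
    odd rotations that follow adds [1]. For a whole line [l = m - 2], so the corrections cancel. *)
Lemma prod_diag_prefix (a : nat -> nat) (l : nat) :
  \prod_(d < l.+2) diag_entry (a d) d =
    zexpg r (2 * (\sum_(d < l.+2) a d)%N%:Z + l%:Z - m%:Z + 2)%R.
Proof.
elim: l => [|l IHl].
  rewrite !big_ord_recr !big_ord0 /= mul1g /diag_entry /=.
  by rewrite (mul_refl_refl rsD); congr (zexpg r _); lia.
have sumS : (\sum_(d < l.+3) a d = \sum_(d < l.+2) a d + a l.+2)%N by rewrite big_ord_recr.
rewrite big_ord_recr IHl sumS /= /diag_entry /= -zexpgD.
by congr (zexpg r _); lia.
Qed.

Lemma prod_diag (h : nat -> gT) (a : nat -> nat) :
  (forall d, (d < m)%N -> h d = diag_entry (a d) d) ->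
  \prod_(k < m) h (k %% m)%N = zexpg r (2 * Posz (\sum_(d < m) a d))%R.
Proof.
move=> h_diag.
have -> : \prod_(k < m) h (k %% m)%N = \prod_(k < m) diag_entry (a k) k.
  by apply: eq_bigr => k _; rewrite modn_small // h_diag.
have := prod_diag_prefix a (m - 2); have -> : (m - 2).+2 = m by lia.
by move->; congr (zexpg r _); lia.
Qed.

Hypothesis m_odd : odd m.

Lemma q_offE (M : 'M[nat]_m) (i j j' : 'I_m) (d : nat) :
  (d < m)%N -> j = iter d (@ordS m) i -> q_off M r s i j j' = off_entry (M i j') d.
Proof.
move=> lt_dm def_j; rewrite /q_off /off_entry.
have := val_iter_ordS d i; rewrite -def_j => val_j.
have lt_i := ltn_ord i; have lt_j := ltn_ord j.
(* Without wrap-around, [i + j] has the parity of [d] and [i < j]. With it, subtracting the odd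
   number [m] flips the parity, but then [j < i], where the definition exchanges the two kinds of
   reflections. *)
have wrap : (j = i + d :> nat \/ j + m = i + d)%N.
  have [lt_id | le_m] := ltnP (i + d) m; first by left; rewrite val_j modn_small.
  by right; rewrite val_j -{1}(subnK le_m) modnDr modn_small; lia.
have -> : (j == i) = (d == 0%N) by rewrite -(inj_eq val_inj) /=; lia.
case: eqP => // d0.
by congr (if _ then _ else _); lia.
Qed.

Let K : int := Posz (((m - 2) * (m - 1)) %/ 2).

(** Abstract sequences [h] and [a] let one computation serve the rows and columns of both
    off-diagonal blocks. *)
Lemma prod_off (h : nat -> gT) (a : nat -> nat) (c : nat) :
  (c < m)%N -> (forall d, (d < m)%N -> h d = off_entry (a d) d) ->
  let mu : int := Posz (\sum_(d < m) a d) in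
  \prod_(k < m) h ((c + k) %% m)%N =
    if odd c || (c == 0%N) then zexpg r (2 * mu - K + 1)%R
    else zexpg r (- (2 * mu) + K - 1)%R.
Proof.
move=> lt_cm h_off mu; rewrite (prod_cyclic_shift h (ltnW lt_cm)).
have prefix l : (l <= m)%N -> \prod_(k < l) h k = \prod_(k < l) off_entry (a k) k.
  by move=> le_lm; apply: eq_bigr => k _; apply: h_off; apply: leq_trans le_lm.
rewrite !prefix ?(ltnW lt_cm) //.
have -> : \prod_(k < m) off_entry (a k) k = zexpg r (2 * mu - K + 1)%R.
  (* A full line is one rotation and [p] pairs of reflections, so the total correction is
     [p (m - 2)], which is [K]; the division in [K] is exact since [m - 1 = 2p]. *)
  have [p def_m] : exists p, m = p.*2.+1 by exists m./2; lia.
  have := prod_off_prefix a p.*2; rewrite -def_m odd_double mulg1 doubleK => ->.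
  have -> : K = (p%:Z * (m%:Z - 2))%R.
    rewrite /K; have -> : ((m - 2) * (m - 1) = p * (m - 2) * 2)%N by rewrite def_m; nia.
    by rewrite mulnK // PoszM; congr (_ * _)%R; lia.
  by congr (zexpg r _); rewrite /mu; ring.
(* From here the offset is [c.+1]: the prefix has [c.+1] entries, of which [c] are reflections, so
   conjugation multiplies the exponent by [(-1)^c]. *)
case: c lt_cm => [|c] lt_cm; first by rewrite big_ord0 conjg1.
rewrite prod_off_prefix (conj_rot rsD) orbF /=.
by case: (odd c); rewrite /= ?GRing.mul1r // ; congr (zexpg r _); ring.
Qed.

End Lines.

(** * Line products of the square [Q] *)

Section Square.

Set Implicit Arguments.
Unset Strict Implicit.
Local Arguments zexpg : simpl never.
Import GroupScope.

Variables (gT : finGroupType) (m : nat) (M : 'M[nat]_m) (r s : gT).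
Hypothesis rsD : dihedral_gens (2 * m ^ 2) r s.
Hypotheses (m_ge3 : (3 <= m)%N) (m_odd : odd m).
Hypothesis magicM : is_magic_square M.

Let mu : int := Posz (magic_const m).
Let K : int := Posz (((m - 2) * (m - 1)) %/ 2).
Let C1 := zexpg r (4 * mu - K + 1)%R.
Let C2 := zexpg r (K - 1)%R.

Let sum_row i : (\sum_(j < m) M i j = magic_const m)%N.
Proof. by case: magicM => _ []. Qed.

Let sum_col j : (\sum_(i < m) M i j = magic_const m)%N.
Proof. by case: magicM => _ []. Qed.

Lemma row_prod_off_block (u v : nat) (i : 'I_m) (c : nat) :
  (c < m)%N -> u \in [:: 1; 2]%N -> v \in [:: 1; 2]%N -> odd (u + v) ->
  row_prod (Qblock M r s u v) i c =
    if odd c || (c == 0%N) then zexpg r (2 * mu - K + 1)%R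
    else zexpg r (- (2 * mu) + K - 1)%R.
Proof.
move=> lt_cm; rewrite !inE => /orP[]/eqP-> /orP[]/eqP-> //= _; rewrite row_prod_shift.
  rewrite (@prod_off _ _ _ _ rsD _ m_ge3 m_odd (fun d => Q12 M r s i (iter d (@ordS m) i))
            (fun d => M i (iter d (@ordS m) i))) //.
    by rewrite sum_iter_ordS sum_row.
  by move=> d lt_dm; rewrite mxE; apply: q_offE.
rewrite (@prod_off _ _ _ _ rsD _ m_ge3 m_odd (fun d => Q21 M r s i (iter d (@ordS m) i))
          (fun d => M i (ordS (iter d (@ordS m) i)))) //.
  (* Row [i] of [Q^21] reads row [i] of [M] shifted by one column, which leaves its sum
     unchanged. *)
  have sum_shift : (\sum_j M i (ordS j) = magic_const m)%N.
    by rewrite -(sum_row i) [RHS](reindex_inj (@ordS_inj m)).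
  by rewrite (sum_iter_ordS (fun j => M i (ordS j))) sum_shift.
by move=> d lt_dm; rewrite mxE; apply: q_offE.
Qed.

(** Columns are read upwards so that the entry at step [d], in row [j - d], again has column minus
    row equal to [d]; [prod_off] then applies as for rows. *)
Lemma col_prod_off_block (u v : nat) (j : 'I_m) (c : nat) :
  (c < m)%N -> u \in [:: 1; 2]%N -> v \in [:: 1; 2]%N -> odd (u + v) ->
  col_prod (Qblock M r s u v) j c =
    if odd c || (c == 0%N) then zexpg r (2 * mu - K + 1)%R
    else zexpg r (- (2 * mu) + K - 1)%R.
Proof.
move=> lt_cm; rewrite !inE => /orP[]/eqP-> /orP[]/eqP-> //= _; rewrite col_prod_shift.
  rewrite (@prod_off _ _ _ _ rsD _ m_ge3 m_odd (fun d => Q12 M r s (iter d (@ord_pred m) j) j)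
            (fun d => M (iter d (@ord_pred m) j) j)) //.
    by rewrite (sum_iter_ord_pred (fun i => M i j)) sum_col.
  by move=> d lt_dm; rewrite mxE; apply: q_offE; rewrite // iter_ord_predK.
rewrite (@prod_off _ _ _ _ rsD _ m_ge3 m_odd (fun d => Q21 M r s (iter d (@ord_pred m) j) j)
          (fun d => M (iter d (@ord_pred m) j) (ordS j))) //.
  (* Column [j] of [Q^21] reads column [j + 1] of [M], whose sum is the same. *)
  by rewrite (sum_iter_ord_pred (fun i => M i (ordS j))) sum_col.
by move=> d lt_dm; rewrite mxE; apply: q_offE; rewrite // iter_ord_predK.
Qed.

Let prod_rot (I : finType) (a : I -> nat) :
  \prod_k zexpg r (2 * a k)%N = zexpg r (2 * Posz (\sum_k a k))%R.
Proof.
have -> : (2 * Posz (\sum_k a k))%R = Posz (2 * \sum_k a k) by rewrite PoszM.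
by rewrite prodgXr -big_distrr.
Qed.

Lemma row_prod_diag_block (u : nat) (i : 'I_m) :
  u \in [:: 1; 2]%N -> row_prod (Qblock M r s u u) i 0 = zexpg r (2 * mu)%R.
Proof.
rewrite !inE => /orP[]/eqP->; rewrite row_prod_shift.
  rewrite /mu -(sum_row i) -(sum_iter_ordS (M i) i) -prod_rot.
  by apply: eq_bigr => k _; rewrite mxE /e_exp iter_ordS_mod.
rewrite (@prod_diag _ _ _ _ rsD _ m_ge3 (fun d => Q22 M r s i (iter d (@ordS m) i))
            (fun d => M i (iter d (@ordS m) i))) //.
  by rewrite sum_iter_ordS sum_row.
by move=> d lt_dm; apply: Q22E.
Qed.

Lemma col_prod_diag_block (v : nat) (j : 'I_m) :
  v \in [:: 1; 2]%N -> col_prod (Qblock M r s v v) j 0 = zexpg r (2 * mu)%R.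
Proof.
rewrite !inE => /orP[]/eqP->; rewrite col_prod_shift.
  rewrite /mu -(sum_col j) -(sum_iter_ord_pred (fun i => M i j) j) -prod_rot.
  by apply: eq_bigr => k _; rewrite mxE /e_exp iter_ord_pred_mod.
rewrite (@prod_diag _ _ _ _ rsD _ m_ge3 (fun d => Q22 M r s (iter d (@ord_pred m) j) j)
            (fun d => M (iter d (@ord_pred m) j) j)) //.
  by rewrite (sum_iter_ord_pred (fun i => M i j)) sum_col.
by move=> d lt_dm; apply: Q22E; rewrite // iter_ord_predK.
Qed.

(** The diagonal block contributes exponent [2 mu], which doubles or cancels the [2 mu] or [- 2 mu]
    of the other block. *)
Lemma row_prod_full (u : nat) (i : 'I_m) (c : nat) :
  (c < m)%N -> u \in [:: 1; 2]%N ->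
  row_prod (Qblock M r s u 1) i (offs u 1 c) * row_prod (Qblock M r s u 2) i (offs u 2 c) =
    if odd c || (c == 0%N) then C1 else C2.
Proof.
move=> lt_cm u12; have := u12; rewrite !inE => /orP[]/eqP def_u; rewrite def_u /offs /=.
  rewrite (row_prod_diag_block i (u := 1)) // (row_prod_off_block (u := 1) (v := 2)) //.
  by case: ifP => _; rewrite -zexpgD; congr (zexpg r _); ring.
rewrite (row_prod_diag_block i (u := 2)) // (row_prod_off_block (u := 2) (v := 1)) //.
by case: ifP => _; rewrite -zexpgD; congr (zexpg r _); ring.
Qed.

Lemma col_prod_full (v : nat) (j : 'I_m) (c : nat) :
  (c < m)%N -> v \in [:: 1; 2]%N ->
  col_prod (Qblock M r s 1 v) j (offs 1 v c) * col_prod (Qblock M r s 2 v) j (offs 2 v c) =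
    if odd c || (c == 0%N) then C1 else C2.
Proof.
move=> lt_cm v12; have := v12; rewrite !inE => /orP[]/eqP def_v; rewrite def_v /offs /=.
  rewrite (col_prod_diag_block j (v := 1)) // (col_prod_off_block (u := 2) (v := 1)) //.
  by case: ifP => _; rewrite -zexpgD; congr (zexpg r _); ring.
rewrite (col_prod_diag_block j (v := 2)) // (col_prod_off_block (u := 1) (v := 2)) //.
by case: ifP => _; rewrite -zexpgD; congr (zexpg r _); ring.
Qed.

(** * Every element of the group occurs exactly once in [Q] *)

Lemma magic_square_entry (a : nat) : (0 < a <= m ^ 2)%N -> exists i j : 'I_m, M i j = a.
Proof.
case: magicM => /perm_mem memM _ a_range.
have : a \in [seq M p.1 p.2 | p : 'I_m * 'I_m] by rewrite memM mem_iota; lia.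
by case/imageP => -[i j] _ ->; exists i, j.
Qed.

(** The entries of [M] form a complete residue system modulo [m^2], so their doubles cover the even
    residues modulo [2 m^2], the order of [r]. *)
Lemma magic_square_residue (z : int) :
  exists i j : 'I_m, zexpg r (2 * z)%R = zexpg r (2 * M i j)%N.
Proof.
have m2_gt0 : (0 < m ^ 2)%N by lia.
(* The shift by one reflects that the entries of [M] run from [1] to [m^2], not from [0]. *)
pose t : int := ((z - 1) %% (m ^ 2)%N)%Z.
have t_ge0 : (0 <= t)%R by apply: modz_ge0; lia.
have t_lt : (t < (m ^ 2)%N)%R by apply: ltz_pmod; lia.
have [i [j Mij]] : exists i j : 'I_m, M i j = `|(t + 1)%R|%N.
  by apply: magic_square_entry; lia.
exists i, j; apply/eqP; rewrite eq_zexpg (dihedral_gens_order rsD) Mij.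
have -> : (2 * z - Posz (2 * `|(t + 1)%R|))%R = (2%N%:Z * ((z - 1) - t))%R by lia.
rewrite abszM dvdn_pmul2l // -[(m ^ 2)%N]/`|Posz (m ^ 2)|%N -dvdzE.
by rewrite -eqz_mod_dvd modz_mod.
Qed.

(** A cell of [M] at cyclic distance [D] from the diagonal is used at residue [D] in [Q^12] and
    [Q^22], and at residue [D - 1] modulo [m] in [Q^21]. For every [D], these three uses are one
    each of the kinds [e] with [s], [t] with [s], and [o]: for [D >= 2], [Q^22] gives the rotation
    while [D] and [D - 1] have opposite parities. *)
Lemma Qsquare_surj (g : gT) : exists p : 'I_(m + m) * 'I_(m + m), g = Qsquare M r s p.1 p.2.
Proof.
pose inQ x := exists p : 'I_(m + m) * 'I_(m + m), x = Qsquare M r s p.1 p.2.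
have in11 i j : inQ (Q11 M r i j).
  by exists (lshift m i, lshift m j); rewrite block_mxEul.
have in12 i d : (d < m)%N -> inQ (off_entry r s m (M i (iter d (@ordS m) i)) d).
  move=> lt_dm; exists (lshift m i, rshift m (iter d (@ordS m) i)).
  by rewrite block_mxEur mxE; apply/esym/q_offE.
have in21 i d : (d < m)%N -> inQ (off_entry r s m (M i (iter d.+1 (@ordS m) i)) d).
  move=> lt_dm; exists (rshift m i, lshift m (iter d (@ordS m) i)).
  by rewrite block_mxEdl mxE; apply/esym/q_offE.
have in22 i d : (d < m)%N -> inQ (diag_entry r s m (M i (iter d (@ordS m) i)) d).
  move=> lt_dm; exists (rshift m i, rshift m (iter d (@ordS m) i)).
  by rewrite block_mxEdr; apply/esym/Q22E.
have in_o i j : inQ (zexpg r (2 * M i j + 1)%N).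
  have [[|[|d]] lt_dm ->] := iter_ordSP i j; first exact: (in12 i 0%N).
    by apply: (in21 i 0%N); lia.
  exact: (in22 i d.+2).
have in_e i j : inQ (zexpg r (2 * M i j)%N * s).
  have [[|d] lt_dm ->] := iter_ordSP i j; first exact: (in22 i 0%N).
  have [d_odd | d_even] := boolP (odd d).
    by have := in21 i d (ltnW lt_dm); rewrite /off_entry d_odd; case: d {lt_dm} d_odd.
  by have := in12 i d.+1 lt_dm; rewrite /off_entry /= d_even.
have in_t i j : inQ (zexpg r (- (2 * M i j)%N%:Z + m%:Z - 2)%R * s).
  have [[|[|d]] lt_dm ->] := iter_ordSP i j; last 1 first.
  - have [d_odd | d_even] := boolP (odd d).
      by have := in21 i d.+1 (ltnW lt_dm); rewrite /off_entry /= d_odd.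
    by have := in12 i d.+2 lt_dm; rewrite /off_entry /= negbK (negPf d_even).
  (* A diagonal cell of [M] is used in [Q^21] at residue [m - 1 = 2p + 2], which is even and
     nonzero, hence of kind [t]. *)
  - have [p def_m] : exists p, m = p.*2.+3 by exists (m - 3)./2; lia.
    have := in21 i p.*2.+2; rewrite -def_m -(iter_ordS_mod m) modnn /off_entry /= odd_double.
    by apply; rewrite def_m.
  exact: (in22 i 1%N).
(* The parity of [a] and the value of [b] decide which of the four kinds of entries produces
   [r^a s^b]. *)
have [a [b ->]] := dihedral_genP rsD g.
case: b; rewrite ?expg1 ?mulg1 /=.
  have [a_odd | a_even] := boolP (odd a).
    (* Solves [- 2 z + m - 2 = a] for [z]; the division is exact because [m] and [a] are odd. *)
    have [i [j eq_ij]] := magic_square_residue ((m%:Z - 2 - a%:Z) %/ 2)%Z.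
    suff -> : zexpg r a = zexpg r (- (2 * M i j)%N%:Z + m%:Z - 2)%R by exact: in_t.
    rewrite -GRing.addrA zexpgD zexpgN -eq_ij -zexpgN -zexpgD.
    by congr (zexpg r _); lia.
  have [i [j eq_ij]] := magic_square_residue (a./2)%:Z.
  suff -> : zexpg r a = zexpg r (2 * M i j)%N by exact: in_e.
  by rewrite -eq_ij; congr (zexpg r _); lia.
have [a_odd | a_even] := boolP (odd a).
  have [i [j eq_ij]] := magic_square_residue (a./2)%:Z.
  suff -> : zexpg r a = zexpg r (2 * M i j + 1)%N by exact: in_o.
  by rewrite PoszD zexpgD -eq_ij -zexpgD; congr (zexpg r _); lia.
have [i [j eq_ij]] := magic_square_residue (a./2)%:Z.
suff -> : zexpg r a = Q11 M r i j by exact: in11.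
by rewrite mxE /e_exp -eq_ij; congr (zexpg r _); lia.
Qed.

Lemma Qsquare_perm : perm_eq [seq Qsquare M r s p.1 p.2 | p : 'I_(m + m) * 'I_(m + m)] (enum gT).
Proof.
rewrite perm_sym; apply: uniq_perm; first exact: enum_uniq; last first.
  move=> g; rewrite mem_enum inE; apply/esym/imageP.
  by have [p ->] := Qsquare_surj g; exists p.
apply: (leq_size_uniq (enum_uniq gT)) => [g _|].
  by apply/imageP; have [p ->] := Qsquare_surj g; exists p.
by rewrite size_image -cardE card_prod !card_ord (card_dihedral_gens rsD); lia.
Qed.

(** * The two magic constants and their coincidence *)

Lemma Qsquare_semi_magic (c : nat) :
  (c < m)%N -> is_semi_magic (Qsquare M r s) (if odd c || (c == 0%N) then C1 else C2).
Proof.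
move=> lt_cm; split.
- by rewrite (card_dihedral_gens rsD); lia.
- exact: Qsquare_perm.
- move=> k; case: (split_ordP k) => i ->.
    have [f def_f] := prod_two_blocks (Qsquare M r s (lshift m i))
      (@iter_ordS_index_inj m i (offs 1 1 c)) (@iter_ordS_index_inj m i (offs 1 2 c)).
    exists f; rewrite def_f -(row_prod_full (u := 1) i lt_cm) //; congr (_ * _).
      by apply: eq_bigr => l _; rewrite block_mxEul.
    by apply: eq_bigr => l _; rewrite block_mxEur.
  have [f def_f] := prod_two_blocks (Qsquare M r s (rshift m i))
    (@iter_ordS_index_inj m i (offs 2 1 c)) (@iter_ordS_index_inj m i (offs 2 2 c)).
  exists f; rewrite def_f -(row_prod_full (u := 2) i lt_cm) //; congr (_ * _).
    by apply: eq_bigr => l _; rewrite block_mxEdl.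
  by apply: eq_bigr => l _; rewrite block_mxEdr.
move=> k; case: (split_ordP k) => j ->.
  have [f def_f] := prod_two_blocks (fun l => Qsquare M r s l (lshift m j))
    (@iter_ord_pred_index_inj m j (offs 1 1 c)) (@iter_ord_pred_index_inj m j (offs 2 1 c)).
  exists f; rewrite def_f -(col_prod_full (v := 1) j lt_cm) //; congr (_ * _).
    by apply: eq_bigr => l _; rewrite block_mxEul.
  by apply: eq_bigr => l _; rewrite block_mxEdl.
have [f def_f] := prod_two_blocks (fun l => Qsquare M r s l (rshift m j))
  (@iter_ord_pred_index_inj m j (offs 1 2 c)) (@iter_ord_pred_index_inj m j (offs 2 2 c)).
exists f; rewrite def_f -(col_prod_full (v := 2) j lt_cm) //; congr (_ * _).
  by apply: eq_bigr => l _; rewrite block_mxEur.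
by apply: eq_bigr => l _; rewrite block_mxEdr.
Qed.

Lemma magic_constants_neq : C1 <> C2 <-> m <> 5.
Proof.
suff eq_C : (C1 == C2) = (m == 5) by split=> neq /eqP; [rewrite -eq_C | rewrite eq_C] => /eqP.
rewrite eq_zexpg (dihedral_gens_order rsD) /mu /K /magic_const.
have [p def_m] : exists p, m = p.*2.+1 by exists m./2; lia.
(* With [m = 2p + 1], half of [m^2 + 1] is [2p^2 + 2p + 1]; both divisions by [2] are removed before
   the exponents are compared. *)
have -> : (m * (m ^ 2 + 1) %/ 2 = m * (2 * (p * p) + 2 * p + 1))%N.
  by rewrite -(@mulnK (m * (2 * (p * p) + 2 * p + 1)) 2) //; congr (_ %/ 2)%N; rewrite def_m; nia.
have -> : ((m - 2) * (m - 1) %/ 2 = (m - 2) * p)%N.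
  by rewrite -(@mulnK ((m - 2) * p) 2) //; congr (_ %/ 2)%N; rewrite def_m; nia.
(* Factoring out [m] lets it cancel against the order [m (2m)] of [r], leaving divisibility by
   [2m]. *)
have -> : (4 * Posz (m * (2 * (p * p) + 2 * p + 1)) - Posz ((m - 2) * p) + 1
    - (Posz ((m - 2) * p) - 1))%R = Posz (m * (m * (2 * m) + 5 - m)).
  have [def_m2 pm] : (Posz (m - 2) = m%:Z - 2 /\ m%:Z = 2 * p%:Z + 1)%R by lia.
  have sub_m : (Posz (m * (2 * m) + 5 - m) = m%:Z * (2 * m%:Z) + 5 - m%:Z)%R by nia.
  by rewrite !PoszM sub_m def_m2 !PoszD !PoszM pm; ring.
rewrite absz_nat (_ : 2 * m ^ 2 = m * (2 * m))%N; last by lia.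
rewrite dvdn_pmul2l; last by lia.
apply/idP/eqP => [dvd_m | ->] //.
(* Modulo [m] the number [2 m^2 + 5 - m] is [5], so [m] divides [5], and [m >= 3] leaves only
   [m = 5]. *)
have : (m %| 5)%N.
  have : (m %| m * (2 * m) + 5)%N.
    rewrite -(@subnK m (m * (2 * m) + 5)); last by nia.
    by rewrite dvdn_addl // (dvdn_trans _ dvd_m) // dvdn_mull.
  by rewrite dvdn_addr // dvdn_mulr.
by case/primeP: (isT : prime 5) => _ primes5 /primes5 /orP[] /eqP; lia.
Qed.

End Square.

Theorem mainTheorem3 (m : nat) (m_ge3 : (3 <= m)%N) (m_odd : odd m)
    (M : 'M[nat]_m) (magicM : is_magic_square M)
    (r s : 'D_(2 * (2 * m ^ 2))) (rsD : dihedral_gens (2 * m ^ 2) r s) :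
  let mu : int := (magic_const m)%:Z%R in
  let K : int := (((m - 2) * (m - 1)) %/ 2)%N%:Z%R in
  let Q := Qblock M r s in
  let C1 := zexpg r (4 * mu - K + 1)%R in
  let C2 := zexpg r (K - 1)%R in
  [/\ forall (u v : nat) (i c : 'I_m),
        u \in [:: 1; 2] -> v \in [:: 1; 2] -> odd (u + v) ->
        row_prod (Q u v) i c =
          if odd c || (c == 0 :> nat) then zexpg r (2 * mu - K + 1)%R
          else zexpg r (- (2 * mu) + K - 1)%R,
      forall (u v : nat) (j c : 'I_m),
        u \in [:: 1; 2] -> v \in [:: 1; 2] -> odd (u + v) ->
        col_prod (Q u v) j c =
          if odd c || (c == 0 :> nat) then zexpg r (2 * mu - K + 1)%R
          else zexpg r (- (2 * mu) + K - 1)%R,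
      forall (u : nat) (i c : 'I_m), u \in [:: 1; 2] ->
        (row_prod (Q u 1%N) i (offs u 1 c) *
         row_prod (Q u 2%N) i (offs u 2 c))%g =
          if odd c || (c == 0 :> nat) then C1 else C2,
      forall (v : nat) (j c : 'I_m), v \in [:: 1; 2] ->
        (col_prod (Q 1%N v) j (offs 1 v c) *
         col_prod (Q 2%N v) j (offs 2 v c))%g =
          if odd c || (c == 0 :> nat) then C1 else C2
    & [/\ is_semi_magic (Qsquare M r s) C1,
          is_semi_magic (Qsquare M r s) C2
        & C1 <> C2 <-> m <> 5]].
Proof.
move=> mu K Q C1 C2; split.
- by move=> u v i c; apply: (row_prod_off_block rsD m_ge3 m_odd magicM).
- by move=> u v j c; apply: (col_prod_off_block rsD m_ge3 m_odd magicM).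
- by move=> u i c; apply: (row_prod_full rsD m_ge3 m_odd magicM).
- by move=> v j c; apply: (col_prod_full rsD m_ge3 m_odd magicM).
split; last exact: (magic_constants_neq rsD m_ge3 m_odd).
  exact: (Qsquare_semi_magic rsD m_ge3 m_odd magicM (c := 0) (ltnW (ltnW m_ge3))).
(* [2] is the least nonzero even offset, and it is below [m] because [m >= 3]. *)
exact: (Qsquare_semi_magic rsD m_ge3 m_odd magicM (c := 2) m_ge3).
Qed.
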